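(* Let $\mathcal H$ be a real or complex Hilbert space and let $T:\mathcal H\to\mathcal H$ be a positive symmetric operator (not necessarily densely defined). If $T$ has any positive self-adjoint extension, then $T_N:=J_T^{**}J_T^*$ is the smallest positive self-adjoint extension of $T$; that is, $T_N$ is a positive self-adjoint extension of $T$, and $T_N\preceq S$ for every positive self-adjoint extension $S$ of $T$.
   Context: A linear operator $T:\mathcal H\to\mathcal H$ is a linear map from a linear subspace $\operatorname{dom}T\subseteq\mathcal H$ into $\mathcal H$. It is symmetric if $\langle Tf,g\rangle=\langle f,Tg\rangle$ for all $f,g\in\operatorname{dom}T$, positive if symmetric with $\langle Tf,f\rangle\ge0$ for $f\in\operatorname{dom}T$, and self-adjoint if densely defined with $T^*=T$. If the positive symmetric operator $T$ has a positive self-adjoint extension, then $\langle Tf,Th\rangle_{\mathcal E}:=\langle Tf,h\rangle$ ($f,h\in\operatorname{dom}T$) is a well-defined inner product on $\operatorname{ran}T$. The energy space $\mathcal E_T$ is the Hilbert space completion of $\operatorname{ran}T$ with respect to it. $J_T:\mathcal E_T\to\mathcal H$ is the operator with $\operatorname{dom}J_T=\operatorname{ran}T\subseteq\mathcal E_T$ and $J_T(Th):=Th$; it is densely defined and closable, $J_T^*:\mathcal H\to\mathcal E_T$ is its adjoint and $J_T^{**}$ its closure. Form order on positive self-adjoint operators: $S_1\preceq S_2$ iff $(I+S_2)^{-1}\le(I+S_1)^{-1}$; equivalently, $\operatorname{dom}S_2^{1/2}\subseteq\operatorname{dom}S_1^{1/2}$ and $\|S_1^{1/2}g\|^2\le\|S_2^{1/2}g\|^2$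 for all $g\in\operatorname{dom}S_2^{1/2}$. *)

(* Defs.v *)
From HB Require Import structures.
From mathcomp Require Import all_boot all_order all_algebra.
From mathcomp Require Export all_classical all_reals topology normedtype.
From mathcomp Require Export complex.

Set Implicit Arguments.
Unset Strict Implicit.
Unset Printing Implicit Defensive.

Import Order.TTheory GRing.Theory Num.Theory.
Import numFieldNormedType.Exports.

Local Open Scope classical_set_scope.
Local Open Scope ring_scope.

(** The real numbers are any [R : realType], the complex numbers are [R[i]];
    theorems about both cases are stated over a field [K] with an involution
    [conj], restricted by [real_or_complex conj]. *)
Inductive real_or_complex :
    forall K : numFieldType, {rmorphism K -> K} -> Prop :=
| RealScalars (R : realType) :
    real_or_complex (idfun : {rmorphism R -> R})
| ComplexScalars (R : realType) :
    real_or_complex (@conjc R : {rmorphism R[i] -> R[i]}).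

(** [{dot H for conj}] is MathComp's type of positive definite forms that are
    linear in the first and [conj]-linear in the second argument. *)
HB.mixin Record isInnerProduct (K : numFieldType) (conj : {rmorphism K -> K}) H
    of NormedModule K H := {
  inner : {dot H for conj} ;
  inner_norm : forall x : H, `|x| ^+ 2 = inner x x
}.

#[short(type="hilbertType")]
HB.structure Definition Hilbert (K : numFieldType) (conj : {rmorphism K -> K}) :=
  {H of CompleteNormedModule K H & isInnerProduct K conj H}.

Notation "''[' x , y ]" := (inner x y)
  (format "''[' x ,  y ]") : ring_scope.

(** An operator between [H1] and [H2] is identified with its graph
    [T : set (H1 * H2)]: [T (f, g)] says that [f] is in the domain of [T] and
    that [T f = g]. Extension is then inclusion, and equality of operators
    (domains included) is equality of sets. *)
Section Operators.
Variables (K : numFieldType) (conj : {rmorphism K -> K}).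

Definition dom (H1 H2 : Type) (T : set (H1 * H2)) : set H1 := fst @` T.
Definition ran (H1 H2 : Type) (T : set (H1 * H2)) : set H2 := snd @` T.

Definition linear_operator (H1 H2 : lmodType K) (T : set (H1 * H2)) : Prop :=
  [/\ T (0, 0),
      forall (a : K) f f' g g', T (f, f') -> T (g, g') ->
        T (a *: f + g, a *: f' + g')
    & forall f g g', T (f, g) -> T (f, g') -> g = g'].

(** The adjoint is an operator exactly when [T] is densely defined; in general
    it is a linear relation. *)
Definition adjoint (H1 H2 : hilbertType conj) (T : set (H1 * H2)) :
    set (H2 * H1) :=
  [set p | forall f g, T (f, g) -> '[g, p.1] = '[f, p.2]].

Variable H : hilbertType conj.
Implicit Types T S A B : set (H * H).

Definition symmetric_operator T : Prop :=
  linear_operator T /\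
  forall f f' g g', T (f, f') -> T (g, g') -> '[f', g] = '[f, g'].

(** When [K] is [R[i]], [0 <= z] means that [z] is real and nonnegative. *)
Definition positive_operator T : Prop :=
  symmetric_operator T /\ forall f f', T (f, f') -> 0 <= '[f', f].

Definition self_adjoint T : Prop :=
  [/\ linear_operator T, dense (dom T) & adjoint T = T].

Definition positive_self_adjoint T : Prop :=
  positive_operator T /\ self_adjoint T.

Definition psa_extension T S : Prop := positive_self_adjoint S /\ T `<=` S.

(** The operator (I + S)^-1. *)
Definition resolvent S : set (H * H) :=
  ([set p | exists2 g, S (p.1, g) & p.2 = p.1 + g]^-1)%relation.

(** The order [A <= B] of everywhere defined operators. *)
Definition operator_le A B : Prop :=
  forall f, exists g h, [/\ A (f, g), B (f, h) & '[g, f] <= '[h, f]].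

Definition form_le S1 S2 : Prop :=
  operator_le (resolvent S2) (resolvent S1).

(** [j] exhibits the Hilbert space [E] as a completion of [ran T] for the inner
    product <T f, T h> := <f', h>, where f' = T f; only the values of [j] on
    [ran T] matter. *)
Definition energy_space T (E : hilbertType conj) (j : H -> E) : Prop :=
  [/\ forall (a : K) x y, ran T x -> ran T y -> j (a *: x + y) = a *: j x + j y,
      forall f f' h h', T (f, f') -> T (h, h') -> '[j f', j h'] = '[f', h]
    & dense (j @` ran T)].

(** The operator from [E] to [H] with domain (the copy in [E] of) [ran T] that
    maps T h, seen in [E], to T h, seen in [H]. *)
Definition energy_map T (E : hilbertType conj) (j : H -> E) : set (E * H) :=
  [set (j x, x) | x in ran T].

(** [B \; A] applies [A] first. *)
Definition krein_von_neumann T (E : hilbertType conj) (j : H -> E) :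
    set (H * H) :=
  let J := energy_map T j in (adjoint (adjoint J) \; adjoint J)%relation.

Definition smallest_psa_extension T N : Prop :=
  psa_extension T N /\ forall S, psa_extension T S -> form_le N S.

End Operators.

(* Main.v *)
Require Import Defs.
From HB Require Import structures.
From mathcomp Require Import all_boot all_order all_algebra.
From mathcomp Require Import all_classical all_reals topology normedtype.
From mathcomp Require Import ring.

(** Everything rests on one approximation principle: for a semi-inner product
    [q] on a subspace [L] and a [q]-bounded antilinear functional [phi] on [L],
    near-minimizers [x] of [q x x - 2 Re (phi x)] satisfy
    [|phi y - q x y|^2 <= e * q y y] for all [y] in [L]; as [e] tends to 0 they
    form a [q]-Cauchy filter.

    - The bounded antilinear functionals on [(L, q)] form a Hilbert space, with
      [<phi, psi>] the limit of [phi] along the filter representing [psi]; the map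
      sending [x] to [q x] makes it the completion of [L], hence the energy space
      when [L] is the graph of [T] and [q] its energy form.
    - With [A = J^*], representing [<u, .>] on the graph of [A] for the graph inner
      product shows that [I + A^* A] is onto, so [N = J^** J^* = A^* A] is
      self-adjoint.
    - If [S] extends [T] and [S g = g'], then [T h |-> <g', h>] is bounded by
      [<g', g>] in the energy norm, so [g] lies in [dom A] and
      [|A g|^2 <= <S g, g>]. For [g = (I + S)^-1 u] and [h = (I + N)^-1 u], the
      Cauchy-Schwarz inequality in the graph of [A] gives
      [<g, u>^2 <= (|g|^2 + |A g|^2) <h, u> <= <g, u> <h, u>]. *)

Set Implicit Arguments.
Unset Strict Implicit.
Unset Printing Implicit Defensive.

Import Order.TTheory GRing.Theory Num.Theory.
Import numFieldNormedType.Exports.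

Local Open Scope classical_set_scope.
Local Open Scope ring_scope.

(** * Real or complex scalars *)

Section Scalars.
Variables (K : numFieldType) (conj : {rmorphism K -> K}).
Hypothesis hK : real_or_complex conj.

Lemma conjrK x : conj (conj x) = x.
Proof. by case: hK x => R x //=; rewrite conjcK. Qed.

Lemma mulr_conj x : x * conj x = `|x| ^+ 2.
Proof.
case: hK x => R x /=; last by rewrite sqr_normc.
by rewrite real_normK ?num_real.
Qed.

Lemma conj_ge0 x : 0 <= x -> conj x = x.
Proof.
move=> x0; have [->|xn0] := eqVneq x 0; first exact: rmorph0.
by apply: (mulfI xn0); rewrite mulr_conj ger0_norm// expr2.
Qed.

Lemma norm_conj x : `|conj x| = `|x|.
Proof.
apply: (pexpIrn (n := 2)) => //; rewrite ?nnegrE //.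
by rewrite -!mulr_conj conjrK mulrC.
Qed.

(** Nonnegative elements of [R[i]] are real, so over the complex numbers the infimum is that of the
    real parts. *)
Lemma nneg_inf (A : set K) : A !=set0 -> (forall x, A x -> 0 <= x) ->
  exists m, (forall x, A x -> m <= x) /\
    forall e, 0 < e -> exists2 x, A x & x <= m + e.
Proof.
case: hK A => R A [a Aa] A0.
  have hA : has_inf A by split; [exists a|exists 0 => x /A0].
  exists (inf A); split=> [x Ax|e e0]; first exact: (ge_inf hA.2).
  by have [x Ax /ltW] := inf_adherent e0 hA; exists x.
pose B : set R := (@complex.Re R) @` A.
have hB : has_inf B.
  by split; [exists (complex.Re a), a|exists 0 => _ [x /A0 + <-]; rewrite lecE => /andP[]].
exists (inf B)%:C%C; split=> [x Ax|e].
  rewrite lecE /= (ger0_Im (A0 _ Ax)) eqxx /=.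
  by apply: (ge_inf hB.2); exists x.
rewrite ltcE => /= /andP[/eqP ei e0].
have [_ [x Ax <-] /ltW xe] := inf_adherent e0 hB.
exists x => //; rewrite lecE.
by rewrite !raddfD /= ei (ger0_Im (A0 _ Ax)) add0r eqxx.
Qed.

Lemma nneg_sqrt x : 0 <= x -> exists2 r : K, 0 <= r & r ^+ 2 = x.
Proof.
case: hK x => R x x0.
  by exists (Num.sqrt x); rewrite ?sqrtr_ge0 ?sqr_sqrtr.
by exists (sqrtc x); rewrite ?sqrtc_ge0 ?sqr_sqrtc.
Qed.

(** In the complex case the real and imaginary parts are 1-Lipschitz, hence send [F] to Cauchy
    filters of reals, whose limits are recombined. *)
Lemma scalar_complete (F : set_system K^o) : ProperFilter F -> cauchy F -> cvg F.
Proof.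
move=> FF Fc; suff [l Fl] : exists l : K, forall e, 0 < e -> \forall x \near F, `|l - x| <= e.
  by apply: (@cvgP K^o F l); apply/cvgrPdist_le.
case: hK F FF Fc => R F FF Fc.
  have /cvg_ex [l /cvgrPdist_le Fl] := R_complete FF Fc.
  by exists l.
have cauchy_part (p : R[i] -> R) : (forall x y, `|p x - p y|%:C%C <= `|x - y|) ->
    exists a, forall e, 0 < e -> \forall x \near F, `|a - p x| <= e.
  move=> p_lip; suff /R_complete : cauchy (p @ F).
    by move=> /cvg_ex [a /cvgrPdist_le Fa]; exists a.
  apply/cauchy_exP => e e0.
  have /cauchyP /(_ (e%:C)%C) := Fc.
  rewrite ltcR => /(_ e0) [x Fx].
  exists (p x); change (F [set y | `|p x - p y| < e]).
  apply: filterS Fx => y xy /=; rewrite -ltcR; exact: le_lt_trans (p_lip _ _) xy.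
have [|a Fa] := cauchy_part (@complex.Re R).
  by move=> x y; rewrite -raddfB; exact: normc_ge_Re.
have [|b Fb] := cauchy_part (@complex.Im R).
  move=> x y; rewrite -raddfB /=.
  (* Up to sign, the imaginary part of [z] is the real part of [i z]. *)
  have := normc_ge_Re ('i * (x - y))%C.
  by rewrite normrM normc_def /= expr0n expr1n add0r sqrtr1 mul1r mulrC ReiNIm normrN.
exists (a +i* b)%C => e.
rewrite ltcE => /= /andP[/eqP ei e0].
have e20 : 0 < complex.Re e / 2 by rewrite divr_gt0.
near=> x.
have -> : (a +i* b)%C - x = (a - complex.Re x)%:C%C + 'i%C * (b - complex.Im x)%:C%C.
  by rewrite [LHS]complexE; congr (_%:C + _ * _%:C)%C; exact: raddfB.
apply: le_trans (ler_normD _ _) _.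
rewrite normrM !normc_def /= !expr0n !expr1n /= !addr0 add0r sqrtr1 mul1r.
rewrite !sqrtr_sqr -rmorphD lecE /= -ei eqxx /=.
rewrite [leRHS](splitr (complex.Re e)); apply: lerD; near: x; [exact: Fa|exact: Fb].
Unshelve. all: by end_near.
Qed.

End Scalars.

(** * Semi-inner products and approximate representation of functionals *)

Section Forms.
Variables (K : numFieldType) (conj : {rmorphism K -> K}).

Record semi_inner (V : lmodType K) (L : set V) (q : V -> V -> K) : Prop := {
  semi_inner0 : L 0;
  semi_inner_closed : forall a x y, L x -> L y -> L (a *: x + y);
  semi_inner_linear : forall a x y z, L x -> L y -> L z ->
    q (a *: x + y) z = a * q x z + q y z;
  semi_innerC : forall x y, L x -> L y -> q y x = conj (q x y);
  semi_inner_ge0 : forall x, L x -> 0 <= q x x }.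

Definition antilinear_on (V : lmodType K) (L : set V) (phi : V -> K) : Prop :=
  forall a x y, L x -> L y -> phi (a *: x + y) = conj a * phi x + phi y.

Definition bounded_by (V : lmodType K) (L : set V) (q : V -> V -> K)
    (phi : V -> K) (C : K) : Prop :=
  forall x, L x -> `|phi x| ^+ 2 <= C * q x x.

Hypothesis hK : real_or_complex conj.

(** For [z != 0], [|z|] times the difference of the two sides is the square of the modulus of
    [z - |z|]. *)
Lemma addr_conj_le z : z + conj z <= 2 * `|z|.
Proof.
have [->|z0] := eqVneq z 0; first by rewrite rmorph0 normr0 mulr0 addr0.
have nz : 0 < `|z| by rewrite normr_gt0.
rewrite -(ler_pM2l nz) -subr_ge0.
have -> : `|z| * (2 * `|z|) - `|z| * (z + conj z) = `|z - `|z| | ^+ 2.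
  rewrite -!(mulr_conj hK) rmorphB (conj_ge0 hK (normr_ge0 z)).
  have := mulr_conj hK z; set n := `|z| => nn.
  by apply: (subIr (z * conj z)); rewrite nn; ring: nn.
by rewrite exprn_ge0.
Qed.

(* The quadratic is evaluated at [t = - s * conj d], with [s = 1 / b] if [b != 0]
   and [s] large otherwise. *)
Lemma discriminant_le (a b d : K) : 0 <= a -> 0 <= b ->
  (forall t, 0 <= a + t * d + conj (t * d) + t * conj t * b) ->
  `|d| ^+ 2 <= a * b.
Proof.
move=> a0 b0 quad.
have quads s : 0 <= s -> 0 <= a - 2 * s * `|d| ^+ 2 + s ^+ 2 * `|d| ^+ 2 * b.
  move=> s0; have := quad (- s * conj d).
  rewrite !rmorphM !rmorphN (conj_ge0 hK s0) (conjrK hK) -(mulr_conj hK d).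
  by congr (0 <= _); ring.
have [bE|bn0] := eqVneq b 0.
  have [->|dn0] := eqVneq d 0; first by rewrite normr0 expr0n mulr_ge0.
  have d2 : 0 < `|d| ^+ 2 by rewrite exprn_gt0 ?normr_gt0.
  have := quads ((a + 1) / `|d| ^+ 2).
  rewrite bE mulr0 addr0 -mulrA divfK ?gt_eqF// => /(_ (divr_ge0 _ (ltW d2))).
  rewrite addr_ge0// => /(_ isT).
  have -> : a - 2 * (a + 1) = - (a + 2) by ring.
  by rewrite oppr_ge0 => /le_gtF; rewrite ltr_wpDl.
have bgt : 0 < b by rewrite lt_def bn0.
have := quads b^-1; rewrite invr_ge0 => /(_ b0).
have -> : a - 2 / b * `|d| ^+ 2 + b^-1 ^+ 2 * `|d| ^+ 2 * b = a - `|d| ^+ 2 / b.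
  by field.
by rewrite subr_ge0 ler_pdivrMr.
Qed.

Lemma sqr_normD_le (x y : K) : `|x + y| ^+ 2 <= 2 * (`|x| ^+ 2 + `|y| ^+ 2).
Proof.
have : 0 <= (`|x| - `|y|) ^+ 2 by rewrite real_exprn_even_ge0 ?rpredB ?normr_real.
have : `|x + y| ^+ 2 <= (`|x| + `|y|) ^+ 2 by rewrite lerXn2r ?nnegrE ?addr_ge0// ler_normD.
move=> h1 h2; apply: le_trans h1 _; rewrite -subr_ge0.
by congr (0 <= _): h2; ring.
Qed.

Lemma norm_le_sqr (E : normedZmodType K) (x : E) (e : K) :
  0 <= e -> `|x| ^+ 2 <= e ^+ 2 -> `|x| <= e.
Proof. by move=> e0; rewrite ler_pXn2r ?nnegrE. Qed.

(** Turns squared bounds [d * M], available for every tolerance [d > 0], into bounds by [e].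
    Dividing by [M + 1] covers [M = 0]. *)
Lemma small_factor (M e : K) : 0 <= M -> 0 < e -> exists2 d, 0 < d & d * M <= e ^+ 2.
Proof.
move=> M0 e0; have M1 : 0 < M + 1 by rewrite ltr_wpDl.
exists (e ^+ 2 / (M + 1)); first by rewrite divr_gt0 ?exprn_gt0.
by rewrite mulrAC ler_pdivrMr// ler_pM2l ?exprn_gt0// lerDl.
Qed.

Lemma sqr_le_linear (r b : K) : 0 <= r -> 0 <= b -> r ^+ 2 <= b * r -> r <= b.
Proof.
move=> r0 b0; have [->//|rn0] := eqVneq r 0.
by rewrite expr2 ler_pM2r// lt_def rn0.
Qed.

Section SemiInner.
Variables (V : lmodType K) (L : set V) (q : V -> V -> K).
Hypothesis qP : semi_inner L q.

Let L0 := semi_inner0 qP.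
Let Llin := semi_inner_closed qP.
Let qlin := semi_inner_linear qP.
Let qC := semi_innerC qP.
Let q0 := semi_inner_ge0 qP.

Lemma semi_inner_closedB x y : L x -> L y -> L (x - y).
Proof. by move=> Lx Ly; rewrite addrC -scaleN1r; exact: Llin. Qed.

Lemma semi_inner_linearr a x y z : L x -> L y -> L z ->
  q z (a *: x + y) = conj a * q z x + q z y.
Proof.
move=> Lx Ly Lz; rewrite (qC (Llin a Lx Ly) Lz) qlin// rmorphD rmorphM.
by rewrite -(qC Lx Lz) -(qC Ly Lz).
Qed.

Lemma semi_innerB x y z : L x -> L y -> L z -> q (x - y) z = q x z - q y z.
Proof.
by move=> Lx Ly Lz; rewrite addrC -scaleN1r qlin// mulN1r addrC.
Qed.

Lemma semi_inner_expand t x y : L x -> L y ->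
  q (t *: y + x) (t *: y + x) =
  q x x + t * q y x + conj (t * q y x) + t * conj t * q y y.
Proof.
move=> Lx Ly; rewrite qlin ?semi_inner_linearr//; last exact: Llin.
by rewrite rmorphM (qC Lx Ly) (conjrK hK); ring.
Qed.

Lemma semi_inner_CS x y : L x -> L y -> `|q x y| ^+ 2 <= q x x * q y y.
Proof.
move=> Lx Ly; rewrite -(norm_conj hK) -qC//; apply: discriminant_le; rewrite ?q0//.
by move=> t; rewrite -semi_inner_expand//; apply/q0/Llin.
Qed.

Lemma antilinear_onB phi x y : antilinear_on L phi -> L x -> L y ->
  phi (x - y) = phi x - phi y.
Proof.
by move=> phiL Lx Ly; rewrite addrC -scaleN1r phiL// rmorphN1 mulN1r addrC.
Qed.

(* Any near-minimizer of [q x x - 2 Re (phi x)] represents [phi] up to a small error. *)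
Lemma approx_riesz phi C e : antilinear_on L phi -> bounded_by L q phi C -> 0 <= C ->
  0 < e -> exists2 x, L x & bounded_by L q (fun y => phi y - q x y) e.
Proof.
(* The constant [D] makes [G] nonnegative, by completing the square in [D * G x]; taking [C + 1]
   instead of [C] makes [D] positive. *)
move=> phiL phiC C0 e0; pose D := C + 1.
have D0 : 0 < D by rewrite ltr_wpDl.
have phiD x : L x -> `|phi x| ^+ 2 <= D * q x x.
  by move=> Lx; apply: le_trans (phiC _ Lx) _; rewrite ler_wpM2r ?q0 ?lerDl.
pose G x := q x x - phi x - conj (phi x) + D.
have G0 x : L x -> 0 <= G x.
  move=> Lx; rewrite -(pmulr_rge0 _ D0).
  have -> : D * G x = (D * q x x - `|phi x| ^+ 2) + `|phi x - D| ^+ 2.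
    rewrite -!(mulr_conj hK) rmorphB (conj_ge0 hK (ltW D0)) /G; ring.
  by rewrite addr_ge0 ?exprn_ge0 ?subr_ge0 ?phiD.
have [||m [mG mx]] := @nneg_inf _ _ hK (G @` L).
- by exists (G 0), 0.
- by move=> _ [x Lx <-]; exact: G0.
have [_ [x Lx <-] xe] := mx e e0.
exists x => // y Ly.
(* For all [t], [G (t *: y + x) >= m >= G x - e]. This is a nonnegative quadratic in [t] with
   constant term [e], leading coefficient [q y y] and linear coefficient the conjugate of
   [q x y - phi y]. *)
rewrite distrC -(norm_conj hK); apply: discriminant_le; rewrite ?(ltW e0) ?q0// => t.
have : m <= G (t *: y + x) by apply: mG; exists (t *: y + x) => //; exact: Llin.
rewrite -subr_ge0 => h1; have : 0 <= (m + e - G x) by rewrite subr_ge0.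
move=> /(addr_ge0 h1); rewrite /G semi_inner_expand// phiL//.
congr (0 <= _); rewrite (qC Lx Ly) !(rmorphM, rmorphB, rmorphD) !(conjrK hK); ring.
Qed.

(** Stands for the Riesz representer of [phi], which may exist only in the completion of [(L, q)]:
    the base sets collect the elements representing [phi] within tolerance [e]. *)
Definition riesz_filter (phi : V -> K) : set_system V :=
  filter_from [set e : K | 0 < e]
    (fun e => [set x | L x /\ bounded_by L q (fun y => phi y - q x y) e]).

Lemma riesz_filter_near phi e : 0 < e ->
  \forall x \near riesz_filter phi, L x /\ bounded_by L q (fun y => phi y - q x y) e.
Proof. by move=> e0; exists e. Qed.

Section Functional.
Variables (phi : V -> K) (C : K).
Hypotheses (phiL : antilinear_on L phi) (phiC : bounded_by L q phi C) (C0 : 0 <= C).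

Lemma riesz_filter_proper : ProperFilter (riesz_filter phi).
Proof.
apply: filter_from_proper; last first.
  by move=> e /(approx_riesz phiL phiC C0) [x Lx xe]; exists x.
apply: filter_from_filter; first by exists 1; exact: ltr01.
(* [e * f / (e + f)] is positive and below both [e] and [f]. *)
move=> e f e0 f0; exists (e * f / (e + f)) => /=.
  by rewrite divr_gt0 ?mulr_gt0 ?addr_gt0.
have ef0 : 0 < e + f by rewrite addr_gt0.
move=> x [Lx xef]; split; split=> // y Ly; apply: le_trans (xef y Ly) _;
  apply: ler_wpM2r; rewrite ?q0// ler_pdivrMr//.
  by rewrite ler_pM2l// lerDr ltW.
by rewrite mulrC ler_pM2l// lerDl ltW.
Qed.

Lemma riesz_filter_cvg y : L y -> (q x y : K^o) @[x --> riesz_filter phi] --> (phi y : K^o).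
Proof.
move=> Ly; have FF := riesz_filter_proper.
apply/cvgrPdist_le => /= e e0.
have [d d0 dM] := small_factor (q0 Ly) e0.
apply: filterS (riesz_filter_near phi d0) => x [Lx /(_ y Ly) xy].
by apply: norm_le_sqr (ltW e0) (le_trans xy dM).
Qed.

(** Testing both approximations against [w = x - y] itself gives [(q w w)^2 <= 2 * (e + e) * q w w],
    and one factor cancels. *)
Lemma bounded_approx_dist e x y : 0 <= e -> L x -> L y ->
  bounded_by L q (fun z => phi z - q x z) e ->
  bounded_by L q (fun z => phi z - q y z) e -> q (x - y) (x - y) <= 4 * e.
Proof.
move=> e0 Lx Ly xe ye; have Lw := semi_inner_closedB Lx Ly.
set w := x - y in Lw *; apply: sqr_le_linear; rewrite ?q0 ?mulr_ge0//.
rewrite -[X in X ^+ 2]ger0_norm ?q0//.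
rewrite {1}(_ : q w w = (phi w - q y w) + - (phi w - q x w)); last first.
  by rewrite {1}/w semi_innerB//; ring.
apply: le_trans (sqr_normD_le _ _) _; rewrite normrN.
apply: le_trans (ler_wpM2l (ler0n _ 2) (lerD (ye _ Lw) (xe _ Lw))) _.
by rewrite le_eqVlt; apply/orP; left; apply/eqP; ring.
Qed.

Lemma riesz_filter_cauchy (E : normedModType K) (p : V -> E) D : 0 <= D ->
  (forall x y, L x -> L y -> `|p x - p y| ^+ 2 <= D * q (x - y) (x - y)) ->
  cauchy (p @ riesz_filter phi).
Proof.
move=> D0 pD; have FF := riesz_filter_proper.
apply/cauchy_exP => e e0.
(* The 4 comes from [bounded_approx_dist]; aiming at [e / 2] leaves room for a strict inequality. *)
have [d d0 dM] := small_factor (mulr_ge0 D0 (ler0n _ 4)) (divr_gt0 e0 (ltr0Sn _ 1)).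
have [x Lx xd] := approx_riesz phiL phiC C0 d0.
exists (p x); suff : \forall y \near riesz_filter phi, `|p x - p y| < e.
  by rewrite -ball_normE.
apply: filterS (riesz_filter_near phi d0) => y [Ly yd].
suff : `|p x - p y| <= e / 2.
  by move/le_lt_trans; apply; rewrite ltr_pdivrMr// mulr_natr mulr2n ltrDl.
apply: norm_le_sqr; first by rewrite divr_ge0// ltW.
apply: le_trans (pD _ _ Lx Ly) _; apply: le_trans dM.
have -> : d * (D * 4) = D * (4 * d) by ring.
rewrite ler_wpM2l//; apply: bounded_approx_dist => //; exact: ltW.
Qed.

End Functional.
End SemiInner.
End Forms.

(** * Limits of scalars along a filter *)

Section ScalarLimits.
Variables (K : numFieldType) (conj : {rmorphism K -> K}).
Hypothesis hK : real_or_complex conj.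
Context (I : Type) (F : set_system I) {FF : ProperFilter F}.

Lemma scalar_cvg_unique (f : I -> K^o) (l m : K^o) : f @ F --> l -> f @ F --> m -> l = m.
Proof. exact: (@cvg_unique _ (@norm_hausdorff _ K^o)). Qed.

(** The values eventually agree with their norms, so [l] and [|l|] are limits of the same function.
    The argument also suits the partial order of the complex numbers. *)
Lemma cvg_ge0 (f : I -> K^o) (l : K^o) : f @ F --> l ->
  (\forall x \near F, 0 <= f x) -> 0 <= l.
Proof.
move=> fl f0; suff -> : l = `|l| by [].
apply: (scalar_cvg_unique fl); apply: cvg_trans (cvg_norm fl).
by apply: near_eq_cvg; apply: filterS f0 => x /ger0_norm.
Qed.

Lemma conj_cvg (f : I -> K^o) (l : K^o) : f @ F --> l ->
  (conj (f x) : K^o) @[x --> F] --> (conj l : K^o).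
Proof.
move=> /cvgrPdist_le fl; apply/cvgrPdist_le => e /fl; apply: filterS => x /=.
by rewrite -(norm_conj hK) rmorphB.
Qed.

Lemma cvg_le_of_near (f g : I -> K^o) (l m : K^o) : f @ F --> l -> g @ F --> m ->
  (\forall x \near F, f x <= g x) -> l <= m.
Proof.
move=> fl gm fg; rewrite -subr_ge0; apply: (cvg_ge0 (cvgB gm fl)).
by apply: filterS fg => x; rewrite subr_ge0.
Qed.

Lemma cvg_norm_sqr (E : normedModType K) (f : I -> E) (l : E) : f @ F --> l ->
  (`|f x| ^+ 2 : K^o) @[x --> F] --> (`|l| ^+ 2 : K^o).
Proof. by move=> /cvg_norm fl; rewrite expr2; under eq_fun do rewrite expr2; exact: cvgM. Qed.

(** Tailored to Riesz filters: [e] is the tolerance of an approximate representer and [M] typically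
    bounds [q] on the vectors tested. *)
Lemma cvg_transfer (f g : I -> K^o) (l : K^o) M :
  f @ F --> l -> 0 <= M ->
  (forall e, 0 < e -> \forall x \near F, `|f x - g x| ^+ 2 <= e * M) -> g @ F --> l.
Proof.
move=> fl M0 fg; rewrite -[l]subr0; rewrite (_ : g = f - (f - g)); last first.
  by apply/funext => x; rewrite !fctE opprB addrC subrK.
apply: cvgB => //; apply/cvgrPdist_le => e e0.
have [d d0 dM] := small_factor M0 e0.
apply: filterS (fg d d0) => x xd; rewrite sub0r normrN.
exact: norm_le_sqr (ltW e0) (le_trans xd dM).
Qed.

End ScalarLimits.

Lemma dense_normP (K : numFieldType) (E : normedModType K) (S : set E) :
  dense S <-> forall x e, 0 < e -> exists2 y, S y & `|x - y| < e.
Proof.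
split=> [Sd x e e0|Sd O [x Ox] Oo].
  have [||y [/interior_subset xy Sy]] := Sd (ball x e)^°.
  - by exists x; exact: nbhsx_ballx.
  - exact: open_interior.
  by exists y => //; move: xy; rewrite -ball_normE.
have /nbhs_ballP [e /= e0 xO] : nbhs x O by apply: open_nbhs_nbhs.
have [y Sy xy] := Sd x e e0; exists y; split=> //; apply: xO.
by rewrite -ball_normE.
Qed.

(** * Completion of a semi-inner product space *)

Section Completion.
Variables (K : numFieldType) (conj : {rmorphism K -> K}).
Hypothesis hK : real_or_complex conj.
Variables (V : lmodType K) (L : set V) (q : V -> V -> K).
Hypothesis qP : semi_inner conj L q.

Let q0 := semi_inner_ge0 qP.

(* Functionals are extended by [0] outside [L], so that equality of functions is
   equality on [L]. *)
Definition bounded_antilinear : {pred V -> K^o} :=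
  mem [set phi : V -> K^o | [/\ forall x, ~ L x -> phi x = 0, antilinear_on conj L phi &
    exists2 C, 0 <= C & bounded_by L q phi C]].

Lemma bounded_antilinear_submod_closed : submod_closed bounded_antilinear.
Proof.
split.
  apply: mem_set; split=> //; first by move=> a x y _ _; rewrite mulr0 addr0.
  by exists 0 => // x Lx; rewrite mul0r normr0 expr0n.
move=> a f g /set_mem [f0 fL [C C0 fC]] /set_mem [g0 gL [D D0 gD]].
apply: mem_set; split.
- by move=> x Lx; change (a * f x + g x = 0); rewrite f0// g0// mulr0 addr0.
- move=> b x y Lx Ly; change (a * f (b *: x + y) + g (b *: x + y) =
    conj b * (a * f x + g x) + (a * f y + g y)); rewrite fL// gL//; ring.
exists (2 * (`|a| ^+ 2 * C + D)).
  by rewrite mulr_ge0// addr_ge0// mulr_ge0// exprn_ge0.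
move=> x Lx; apply: le_trans (sqr_normD_le (a * f x) (g x)) _.
have -> : 2 * (`|a| ^+ 2 * C + D) * q x x = 2 * (`|a| ^+ 2 * (C * q x x) + D * q x x).
  by ring.
rewrite ler_wpM2l// lerD ?gD// normrM exprMn ler_wpM2l ?exprn_ge0//.
exact: fC.
Qed.

HB.instance Definition _ :=
  GRing.isSubmodClosed.Build K (V -> K^o) bounded_antilinear bounded_antilinear_submod_closed.

(** Antilinear functionals make [x |-> q x] linear. Vectors with [q x x = 0] give the zero
    functional, so no quotient has to be formed. *)
Record completion := Completion {
  functional :> V -> K^o; functionalP : functional \in bounded_antilinear }.

HB.instance Definition _ := [isSub for functional].
HB.instance Definition _ := [Choice of completion by <:].
HB.instance Definition _ := [SubChoice_isSubLmodule of completion by <:].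

Implicit Types phi psi : completion.

Lemma completion_out phi x : ~ L x -> phi x = 0.
Proof. by have /set_mem [+ _ _] := functionalP phi; apply. Qed.

Lemma completion_antilinear phi : antilinear_on conj L phi.
Proof. by have /set_mem [] := functionalP phi. Qed.

Lemma completion_bounded phi : exists2 C, 0 <= C & bounded_by L q phi C.
Proof. by have /set_mem [] := functionalP phi. Qed.

Let Phi phi := riesz_filter L q phi.

Let Phi_proper phi : ProperFilter (Phi phi).
Proof.
have [C C0 phiC] := completion_bounded phi.
exact: (riesz_filter_proper hK qP (completion_antilinear phi) phiC C0).
Qed.
Local Existing Instance Phi_proper.

(** For [psi = q x] this is [phi x], the reproducing property; the limit extends it to every
    [psi]. *)
Definition completion_dot phi psi : K^o := lim (phi x @[x --> Phi psi]).

Lemma completion_dot_cvg phi psi : phi x @[x --> Phi psi] --> completion_dot phi psi.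
Proof.
have [C C0 phiC] := completion_bounded phi; have [D D0 psiD] := completion_bounded psi.
apply: (@scalar_complete _ _ hK _ (fmap_proper_filter _ _)).
apply: (@riesz_filter_cauchy _ _ hK _ _ _ qP psi D _ psiD D0 K^o phi C) => //.
  exact: completion_antilinear.
move=> x y Lx Ly; rewrite -(antilinear_onB (completion_antilinear phi))//.
by apply: phiC; exact: (semi_inner_closedB qP).
Qed.

Arguments completion_dot_cvg : clear implicits.

(** Testing an approximate representer [x] of tolerance 1 against itself gives
    [(q x x)^2 <= 2 * (C + 1) * q x x]. The bound makes errors [e * q x x] uniformly small. *)
Lemma completion_near_bounded phi : exists2 M, 0 <= M &
  \forall x \near Phi phi, L x /\ q x x <= M.
Proof.
have [C C0 phiC] := completion_bounded phi.
exists (2 * (1 + C)); first by rewrite mulr_ge0 ?addr_ge0.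
apply: filterS (riesz_filter_near L q phi ltr01) => x [Lx xe]; split=> //.
apply: sqr_le_linear; rewrite ?q0 ?mulr_ge0 ?addr_ge0//.
rewrite -[X in X ^+ 2]ger0_norm ?q0// -[X in `|X|](subKr (phi x)).
rewrite addrC; apply: le_trans (sqr_normD_le _ _) _; rewrite normrN -mulrA ler_wpM2l//.
by rewrite mulrDl lerD ?phiC//; exact: xe.
Qed.

(** Along the product of the two filters, [q x y] approximates [phi y] while its conjugate [q y x]
    approximates [psi x], so one double limit computes both products. *)
Lemma completion_dotC phi psi : completion_dot psi phi = conj (completion_dot phi psi).
Proof.
have [M M0 phiM] := completion_near_bounded phi.
have [N N0 psiN] := completion_near_bounded psi.
pose G := filter_prod (Phi phi) (Phi psi).
have GF : ProperFilter G by exact: filter_prod_proper.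
have near1 P : (\forall x \near Phi phi, P x) -> \forall p \near G, P p.1.
  exact: cvg_fst.
have near2 P : (\forall x \near Phi psi, P x) -> \forall p \near G, P p.2.
  exact: cvg_snd.
have phi2 : (phi p.2 : K^o) @[p --> G] --> completion_dot phi psi.
  move=> A /(completion_dot_cvg phi psi); exact: near2.
have psi1 : (psi p.1 : K^o) @[p --> G] --> completion_dot psi phi.
  move=> A /(completion_dot_cvg psi phi); exact: near1.
have q_phi : (q p.1 p.2 : K^o) @[p --> G] --> completion_dot phi psi.
  apply: (cvg_transfer phi2 N0) => e e0.
  apply: filterS2 (near1 _ (riesz_filter_near L q phi e0)) (near2 _ psiN).
  move=> [x y] [/= Lx xe] [Ly yN]; apply: le_trans (xe y Ly) _.
  by rewrite ler_wpM2l// ltW.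
have q_psi : (conj (q p.1 p.2) : K^o) @[p --> G] --> completion_dot psi phi.
  apply: (cvg_transfer psi1 M0) => e e0.
  apply: filterS2 (near2 _ (riesz_filter_near L q psi e0)) (near1 _ phiM).
  move=> [x y] [/= Ly ye] [Lx xM]; rewrite -(semi_innerC qP)//.
  by apply: le_trans (ye x Lx) _; rewrite ler_wpM2l// ltW.
exact: (scalar_cvg_unique q_psi (conj_cvg hK q_phi)).
Qed.

Lemma completion_dotPl a phi psi xi :
  completion_dot (a *: phi + psi) xi = a * completion_dot phi xi + completion_dot psi xi.
Proof.
apply: (scalar_cvg_unique (completion_dot_cvg (a *: phi + psi) xi)).
exact: cvgD (cvgMl_tmp (completion_dot_cvg phi xi)) (completion_dot_cvg psi xi).
Qed.

Lemma completion_dotPr a phi psi xi :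
  completion_dot xi (a *: phi + psi) =
  conj a * completion_dot xi phi + completion_dot xi psi.
Proof.
by rewrite completion_dotC completion_dotPl rmorphD rmorphM -!(completion_dotC _ xi).
Qed.

Lemma completion_dot_self_cvg phi : (q x x : K^o) @[x --> Phi phi] --> completion_dot phi phi.
Proof.
have [M M0 phiM] := completion_near_bounded phi.
apply: (cvg_transfer (completion_dot_cvg phi phi) M0) => e e0.
apply: filterS2 (riesz_filter_near L q phi e0) phiM => x [Lx xe] [_ xM].
by apply: le_trans (xe x Lx) _; rewrite ler_wpM2l// ltW.
Qed.

Arguments completion_dot_self_cvg : clear implicits.

Lemma completion_dot_ge0 phi : 0 <= completion_dot phi phi.
Proof.
apply: (cvg_ge0 (completion_dot_self_cvg phi)).
by apply: filterS (riesz_filter_near L q phi ltr01) => x [Lx _]; exact: q0.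
Qed.

Lemma completion_dot_bound phi : bounded_by L q phi (completion_dot phi phi).
Proof.
have [C C0 phiC] := completion_bounded phi; move=> y Ly.
have phiy := riesz_filter_cvg hK qP (completion_antilinear phi) phiC C0 Ly.
apply: (cvg_le_of_near (cvg_norm_sqr phiy)
  (cvgMr_tmp (b := q y y) (completion_dot_self_cvg phi))).
apply: filterS (riesz_filter_near L q phi ltr01) => x [Lx _].
exact: (semi_inner_CS hK qP).
Qed.

Arguments completion_dot_bound : clear implicits.

(** Together with [completion_dot_bound] this identifies the squared norm as the best bound of
    [phi]. Along the filter of [phi], both [phi x] and [q x x] tend to [d = <phi, phi>], so the
    bound becomes [d^2 <= C * d]. *)
Lemma completion_dot_least phi C : 0 <= C -> bounded_by L q phi C -> completion_dot phi phi <= C.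
Proof.
move=> C0 phiC; apply: sqr_le_linear; rewrite ?completion_dot_ge0//.
rewrite -[X in X ^+ 2]ger0_norm ?completion_dot_ge0//.
apply: (cvg_le_of_near (cvg_norm_sqr (completion_dot_cvg phi phi))
  (cvgMl_tmp (a := C) (completion_dot_self_cvg phi))).
by apply: filterS (riesz_filter_near L q phi ltr01) => x [Lx _]; exact: phiC.
Qed.

Lemma completion_dot_eq0 phi : completion_dot phi phi = 0 -> phi = 0.
Proof.
move=> phi0; apply: val_inj; apply/funext => x /=.
have [Lx|/completion_out//] := pselect (L x).
have := completion_dot_bound phi x Lx; rewrite phi0 mul0r => h.
apply/eqP; rewrite -normr_eq0 -sqrf_eq0 eq_le h exprn_ge0//.
Qed.

Lemma completion_dot_semi_inner : semi_inner conj [set: completion] completion_dot.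
Proof.
split=> //; first by move=> *; exact: completion_dotPl.
- by move=> *; exact: completion_dotC.
- by move=> *; exact: completion_dot_ge0.
Qed.

Fact completion_norm_ex phi : exists r : K, 0 <= r /\ r ^+ 2 = completion_dot phi phi.
Proof. by have [r] := nneg_sqrt hK (completion_dot_ge0 phi); exists r. Qed.

Definition completion_norm phi : K := sval (cid (completion_norm_ex phi)).

Lemma completion_norm_ge0 phi : 0 <= completion_norm phi.
Proof. by rewrite /completion_norm; case: cid => r []. Qed.

Lemma completion_normE phi : completion_norm phi ^+ 2 = completion_dot phi phi.
Proof. by rewrite /completion_norm; case: cid => r []. Qed.

Lemma completion_normD phi psi :
  completion_norm (phi + psi) <= completion_norm phi + completion_norm psi.
Proof.
have n0 := completion_norm_ge0; rewrite -(ler_pXn2r (n := 2)) ?nnegrE ?addr_ge0 ?n0//.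
rewrite completion_normE -[psi in X in X <= _]scale1r addrC.
rewrite (semi_inner_expand hK completion_dot_semi_inner)// rmorph1 !mul1r -!completion_normE.
set d := completion_dot _ _.
have dle : `|d| <= completion_norm phi * completion_norm psi.
  apply: norm_le_sqr; rewrite ?mulr_ge0 ?n0// exprMn !completion_normE mulrC.
  exact: (semi_inner_CS hK completion_dot_semi_inner).
rewrite -[X in X + _ <= _]addrA sqrrD lerD2r lerD2l -mulr_natl.
by apply: le_trans (addr_conj_le hK d) _; rewrite ler_wpM2l.
Qed.

Lemma completion_normZ a phi : completion_norm (a *: phi) = `|a| * completion_norm phi.
Proof.
apply: (pexpIrn (n := 2)) => //; rewrite ?nnegrE ?mulr_ge0 ?completion_norm_ge0//.
rewrite exprMn !completion_normE -(mulr_conj hK) -[a *: phi]addr0.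
rewrite completion_dotPl completion_dotPr.
have dot0 psi : completion_dot psi 0 = 0.
  have := completion_dotPr 1 0 0 psi; rewrite scale1r addr0 rmorph1 mul1r.
  by move=> /esym/(canRL (addKr _)); rewrite addNr.
by rewrite [completion_dot 0 _]completion_dotC !dot0 rmorph0 !addr0 mulrA.
Qed.

Lemma completion_norm0_eq0 phi : completion_norm phi = 0 -> phi = 0.
Proof.
by move=> phi0; apply: completion_dot_eq0; rewrite -completion_normE phi0 expr0n.
Qed.

HB.instance Definition _ := Lmodule_isNormed.Build K completion
  completion_normD completion_normZ completion_norm0_eq0.

Lemma completion_eval_le phi x : L x -> `|phi x| ^+ 2 <= `|phi| ^+ 2 * q x x.
Proof. by rewrite [X in _ <= X * _]completion_normE; exact: completion_dot_bound. Qed.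

(** The limit is the pointwise limit [Psi], which exists because evaluations are Lipschitz.
    Closeness in norm passes to [Psi] pointwise by [Psi_close], and [completion_dot_least] turns it
    back into closeness in norm. *)
Lemma completion_complete (F : set_system completion) : ProperFilter F -> cauchy F -> cvg F.
Proof.
move=> FF Fc.
have F_small e : 0 < e -> exists phi, \forall psi \near F, `|phi - psi| < e.
  by move=> e0; have /cauchyP /(_ e e0) [phi] := Fc; rewrite -ball_normE; exists phi.
have /choice [Psi FPsi] x : exists l : K^o, (functional phi x : K^o) @[phi --> F] --> l.
  apply/cvg_ex; apply: (@scalar_complete _ _ hK _ (fmap_proper_filter _ _)).
  apply/cauchy_exP => e e0; rewrite -ball_normE.
  suff [l Fl] : exists l : K, \forall phi \near F, `|l - functional phi x| < e by exists l.
  have [Lx|nLx] := pselect (L x); last first.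
    exists 0; apply: filterS filterT => phi _ /=.
    by rewrite completion_out// subrr normr0.
  have [d d0 dq] := small_factor (q0 Lx) (divr_gt0 e0 (ltr0Sn _ 1)).
  have [r r0 rd] := nneg_sqrt hK (ltW d0).
  have [|phi Fphi] := F_small r; first by rewrite lt_def r0 andbT -sqrf_eq0 rd gt_eqF.
  exists (phi x); apply: filterS Fphi => psi /ltW phi_psi.
  suff : `|phi x - psi x| <= e / 2.
    by move/le_lt_trans; apply; rewrite ltr_pdivrMr// mulr_natr mulr2n ltrDl.
  apply: norm_le_sqr; first by rewrite divr_ge0// ltW.
  apply: le_trans (completion_eval_le (phi - psi) Lx) _; apply: le_trans dq.
  by rewrite ler_wpM2r ?q0// -rd lerXn2r ?nnegrE.
have Psi_close e phi : 0 <= e -> (\forall psi \near F, `|phi - psi| < e) ->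
    bounded_by L q (fun x => phi x - Psi x) (e ^+ 2).
  move=> e0 Fphi x Lx.
  have Fx : ((phi x - functional psi x : K^o) @[psi --> F]) --> (phi x - Psi x : K^o).
    exact: cvgB (cvg_cst _) (FPsi x).
  apply: (cvg_le_of_near (cvg_norm_sqr Fx) (cvg_cst _)).
  apply: filterS Fphi => psi /ltW phi_psi.
  apply: le_trans (completion_eval_le (phi - psi) Lx) _.
  by rewrite ler_wpM2r ?q0// lerXn2r ?nnegrE.
have PsiP : Psi \in bounded_antilinear.
  apply: mem_set; split.
  - move=> x nLx; apply: (scalar_cvg_unique (FPsi x)).
    by under eq_fun do rewrite completion_out//; exact: cvg_cst.
  - move=> a x y Lx Ly; apply: (scalar_cvg_unique (FPsi _)).
    under eq_fun do rewrite completion_antilinear//.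
    exact: cvgD (cvgMl_tmp (FPsi x)) (FPsi y).
  have [phi Fphi] := F_small 1 ltr01; have [C C0 phiC] := completion_bounded phi.
  exists (2 * (C + 1)) => [|x Lx]; first by rewrite mulr_ge0 ?addr_ge0.
  rewrite -[Psi x](subKr (phi x)); apply: le_trans (sqr_normD_le _ _) _.
  rewrite normrN -mulrA ler_wpM2l// mulrDl lerD ?phiC//.
  by have := Psi_close 1 phi ler01 Fphi x Lx; rewrite expr1n.
apply: (@cvgP _ _ (Completion PsiP)); apply/cvgrPdist_le => e e0.
have [|phi Fphi] := F_small (e / 2); first by rewrite divr_gt0.
have e2 : 0 <= e / 2 by rewrite divr_ge0// ltW.
have phi_Psi : `|phi - Completion PsiP| <= e / 2.
  rewrite -(ler_pXn2r (n := 2)) ?nnegrE// [X in X <= _]completion_normE.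
  by apply: completion_dot_least; rewrite ?exprn_ge0//; exact: Psi_close.
apply: filterS Fphi => psi /ltW phi_psi.
rewrite [e](splitr e) -(subrKA phi); apply: le_trans (ler_normD _ _) _.
by rewrite lerD// distrC.
Qed.

HB.instance Definition _ := Uniform_isComplete.Build completion completion_complete.

Definition completion_inner (phi psi : completion) : K := completion_dot phi psi.

Fact completion_inner_bilinear : bilinear_for *%R (conj \; *%R) completion_inner.
Proof.
by split=> xi a phi psi; [exact: completion_dotPl|exact: completion_dotPr].
Qed.

HB.instance Definition _ := bilinear_isBilinear.Build K completion completion K *%R
  (conj \; *%R) completion_inner completion_inner_bilinear.

Fact completion_inner_herm phi psi :
  completion_inner phi psi = (-1) ^+ false * conj (completion_inner psi phi).
Proof. by rewrite expr0 mul1r; exact: completion_dotC. Qed.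

HB.instance Definition _ := isHermitianSesquilinear.Build K completion false conj
  completion_inner completion_inner_herm.

Fact completion_inner_gt0 phi : phi != 0 -> 0 < completion_inner phi phi.
Proof.
move=> phi0; rewrite lt_def completion_dot_ge0 andbT.
by apply: contra_neq phi0; exact: completion_dot_eq0.
Qed.

HB.instance Definition _ := isDotProduct.Build K completion completion_inner completion_inner_gt0.

Fact completion_inner_norm phi : `|phi| ^+ 2 = completion_inner phi phi.
Proof. exact: completion_normE. Qed.

HB.instance Definition _ := isInnerProduct.Build K conj completion completion_inner_norm.

Fact to_completion_subproof x : L x ->
  (fun y => if pselect (L y) then q x y else 0) \in bounded_antilinear.
Proof.
move=> Lx; have E u : L u -> (if pselect (L u) then q x u else 0) = q x u.
  by case: pselect.
apply: mem_set; split=> [y nLy|a y z Ly Lz|]; first by case: pselect.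
  by rewrite !E ?(semi_inner_linearr qP)//; exact: (semi_inner_closed qP).
exists (q x x); first exact: q0.
by move=> y Ly; rewrite E//; exact: (semi_inner_CS hK qP).
Qed.

Lemma hilbert_completion_ex : exists (E : hilbertType conj) (j : V -> E),
  [/\ forall a x y, L x -> L y -> j (a *: x + y) = a *: j x + j y,
      forall x y, L x -> L y -> '[j x, j y] = q x y
    & dense (j @` L)].
Proof.
pose j x : completion :=
  if pselect (L x) is left Lx then Completion (to_completion_subproof Lx) else 0.
have jE x y : L x -> L y -> j x y = q x y.
  by rewrite /j => Lx Ly; do 2! case: pselect => //= ?.
exists completion, j; split.
- move=> a x y Lx Ly; have Laxy := semi_inner_closed qP a Lx Ly.
  apply: val_inj; apply/funext => z.
  change (j (a *: x + y) z = a * j x z + j y z).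
  have [Lz|nLz] := pselect (L z); first by rewrite !jE// (semi_inner_linear qP).
  by rewrite !completion_out// mulr0 addr0.
(* As [z] runs along the filter of [j y], [j x z = q x z] is the conjugate of [q z x], which tends
   to [j y x = q y x]. *)
- move=> x y Lx Ly; have [C C0 jyC] := completion_bounded (j y).
  apply: (scalar_cvg_unique (completion_dot_cvg (j x) (j y))).
  have conj_q := conj_cvg hK (FF := Phi_proper (j y))
    (riesz_filter_cvg hK qP (completion_antilinear (j y)) jyC C0 Lx).
  rewrite (semi_innerC qP Ly Lx) -jE//; apply: (cvg_transfer conj_q ler01) => e e0.
  apply: filterS (riesz_filter_near L q (j y) ltr01) => z [Lz _].
  by rewrite jE// (semi_innerC qP Lz Lx) subrr normr0 expr0n mulr1 ltW.
apply/dense_normP => phi e e0; have e2 : 0 < e / 2 by rewrite divr_gt0.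
have [C C0 phiC] := completion_bounded phi.
(* By [completion_dot_least], representing [phi] with tolerance [(e / 2)^2] means lying within
   [e / 2] of it in norm. *)
have [x Lx xe] := approx_riesz hK qP (completion_antilinear phi) phiC C0 (exprn_gt0 2 e2).
exists (j x); first by exists x.
apply: (@le_lt_trans _ _ (e / 2)); last by rewrite ltr_pdivrMr// mulr_natr mulr2n ltrDl.
apply: norm_le_sqr; first exact: ltW.
rewrite [X in X <= _]completion_normE; apply: completion_dot_least.
  by rewrite exprn_ge0// ltW.
move=> y Ly; change (`|phi y - j x y| ^+ 2 <= (e / 2) ^+ 2 * q y y).
by rewrite jE//; exact: xe.
Qed.

End Completion.

(** * Hilbert spaces *)

Section HilbertSpaces.
Variables (K : numFieldType) (conj : {rmorphism K -> K}).
Hypothesis hK : real_or_complex conj.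
Implicit Types E : hilbertType conj.

Lemma innerC E (x y : E) : '[y, x] = conj '[x, y].
Proof. by rewrite hermC expr0 mul1r. Qed.

Lemma innerPl E a (x y z : E) : '[a *: x + y, z] = a * '[x, z] + '[y, z].
Proof. exact: linearPl. Qed.

Lemma innerPr E a (x y z : E) : '[z, a *: x + y] = conj a * '[z, x] + '[z, y].
Proof. exact: linearPr. Qed.

Lemma innerDl E (x y z : E) : '[x + y, z] = '[x, z] + '[y, z].
Proof. exact: linearDl. Qed.

Lemma innerDr E (x y z : E) : '[z, x + y] = '[z, x] + '[z, y].
Proof. exact: linearDr. Qed.

Lemma innerBl E (x y z : E) : '[x - y, z] = '[x, z] - '[y, z].
Proof. exact: linearBl. Qed.

Lemma innerBr E (x y z : E) : '[z, x - y] = '[z, x] - '[z, y].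
Proof. exact: linearBr. Qed.

Lemma inner0l E (x : E) : '[0, x] = 0.
Proof. exact: linear0l. Qed.

Lemma inner0r E (x : E) : '[x, 0] = 0.
Proof. exact: linear0r. Qed.

Lemma inner_ge0 E (x : E) : 0 <= '[x, x].
Proof. by rewrite -inner_norm exprn_ge0. Qed.

Lemma inner_eq0 E (x : E) : '[x, x] = 0 -> x = 0.
Proof. by rewrite -inner_norm => /eqP; rewrite sqrf_eq0 normr_eq0 => /eqP. Qed.

(** Meant for the projections of a graph: the pullbacks along [fst] and [snd] add up to the graph
    inner product. *)
Lemma semi_inner_comp (V : lmodType K) (L : set V) E (p : V -> E) :
  L 0 -> (forall a x y, L x -> L y -> L (a *: x + y)) ->
  (forall a x y, L x -> L y -> p (a *: x + y) = a *: p x + p y) ->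
  semi_inner conj L (fun x y => '[p x, p y]).
Proof.
move=> L0 Llin plin; split=> //.
- by move=> a x y z Lx Ly _; rewrite plin// innerPl.
- by move=> x y _ _; exact: innerC.
- by move=> x _; exact: inner_ge0.
Qed.

Lemma inner_semi_inner E : semi_inner conj [set: E] (fun x y => '[x, y]).
Proof. exact: (@semi_inner_comp _ _ _ id). Qed.

Lemma semi_innerD (V : lmodType K) (L : set V) (q r : V -> V -> K) :
  semi_inner conj L q -> semi_inner conj L r ->
  semi_inner conj L (fun x y => q x y + r x y).
Proof.
move=> [L0 Llin qlin qC q0] [_ _ rlin rC r0]; split=> //.
- by move=> a x y z Lx Ly Lz; rewrite qlin// rlin//; ring.
- by move=> x y Lx Ly; rewrite qC// rC// rmorphD.
- by move=> x Lx; rewrite addr_ge0 ?q0 ?r0.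
Qed.

Lemma inner_CS E (x y : E) : `|'[x, y]| <= `|x| * `|y|.
Proof.
apply: norm_le_sqr; first by rewrite mulr_ge0.
by rewrite exprMn !inner_norm; exact: (semi_inner_CS hK (inner_semi_inner E)).
Qed.

Lemma inner_bounded E (V : lmodType K) (L : set V) (q : V -> V -> K) (p : V -> E) u :
  (forall x, L x -> `|p x| ^+ 2 <= q x x) ->
  bounded_by L q (fun x => '[u, p x]) (`|u| ^+ 2).
Proof.
move=> pq x Lx; apply: (@le_trans _ _ (`|u| ^+ 2 * `|p x| ^+ 2)).
  by rewrite -exprMn lerXn2r ?nnegrE ?mulr_ge0// inner_CS.
by rewrite ler_wpM2l ?exprn_ge0// pq.
Qed.

Lemma inner_antilinear E (V : lmodType K) (L : set V) (p : V -> E) u :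
  (forall a x y, L x -> L y -> p (a *: x + y) = a *: p x + p y) ->
  antilinear_on conj L (fun x => '[u, p x]).
Proof. by move=> plin a x y Lx Ly; rewrite plin// innerPr. Qed.

Section Limits.
Context (I : Type) (F : set_system I) {FF : ProperFilter F}.

Lemma inner_cvgl E (f : I -> E) (l y : E) : f @ F --> l ->
  ('[f x, y] : K^o) @[x --> F] --> ('[l, y] : K^o).
Proof.
move=> /cvgrPdist_le fl; apply/cvgrPdist_le => e e0.
have y1 : 0 < `|y| + 1 by rewrite ltr_wpDl.
apply: filterS (fl _ (divr_gt0 e0 y1)) => x xe.
rewrite -innerBl; apply: le_trans (inner_CS _ _) _.
apply: le_trans (ler_wpM2r (normr_ge0 _) xe) _.
by rewrite mulrAC ler_pdivrMr// ler_pM2l// lerDl.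
Qed.

Lemma inner_cvgr E (f : I -> E) (l y : E) : f @ F --> l ->
  ('[y, f x] : K^o) @[x --> F] --> ('[y, l] : K^o).
Proof.
move=> /(inner_cvgl (y := y)) /(conj_cvg hK); rewrite -innerC.
by under eq_fun do rewrite -innerC.
Qed.

End Limits.

(** If [x != 0], some [y] in [D] lies within [|x|] of [x], and [|x|^2 = <x - y, x> <= |x - y| |x| <
    |x|^2]. *)
Lemma dense_inner0 E (D : set E) x : dense D -> (forall y, D y -> '[y, x] = 0) -> x = 0.
Proof.
move=> /dense_normP Dd Dx; apply/eqP; apply: contraT => x0.
have nx : 0 < `|x| by rewrite normr_gt0.
have [y Dy xy] := Dd x _ nx.
have : `|x| ^+ 2 <= `|x - y| * `|x|.
  rewrite inner_norm -[X in X <= _]ger0_norm ?inner_ge0//.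
  have -> : '[x, x] = '[x - y, x] by rewrite innerBl (Dx y Dy) subr0.
  exact: inner_CS.
by rewrite expr2 ler_pM2r// => /le_gtF; rewrite xy.
Qed.

Section RieszLimits.
Variables (V : lmodType K) (L : set V) (q : V -> V -> K) (phi : V -> K) (C : K).
Hypotheses (qP : semi_inner conj L q) (phiL : antilinear_on conj L phi).
Hypotheses (phiC : bounded_by L q phi C) (C0 : 0 <= C).

(** Here approximate representers yield an actual vector: their images under a [q]-contractive [p]
    form a Cauchy filter in the complete space [E]. *)
Lemma riesz_filter_limit E (p : V -> E) :
  (forall x y, L x -> L y -> `|p x - p y| ^+ 2 <= q (x - y) (x - y)) ->
  exists v : E, p @ riesz_filter L q phi --> v.
Proof.
move=> pq; have FF := riesz_filter_proper hK qP phiL phiC C0.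
apply/cvg_ex; apply: (@cauchy_cvg _ _ (fmap_proper_filter _ _)).
apply: (riesz_filter_cauchy hK qP phiL phiC C0 ler01) => x y Lx Ly.
by rewrite mul1r; exact: pq.
Qed.

End RieszLimits.

(** Representing [<u, .>] on [L] produces the orthogonal projection [v] of [u] onto the closure of
    [L]; then [u - v] is orthogonal to [L], hence zero. *)
Lemma dense_of_orthogonal0 E (L : set E) : L 0 ->
  (forall a x y, L x -> L y -> L (a *: x + y)) ->
  (forall x, (forall y, L y -> '[x, y] = 0) -> x = 0) -> dense L.
Proof.
move=> L0 Llin Lorth; apply/dense_normP => u e e0.
have qP := @semi_inner_comp _ _ _ id L0 Llin (fun _ _ _ _ _ => erefl).
have phiL := @inner_antilinear _ _ L id u (fun _ _ _ _ _ => erefl).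
have phiC : bounded_by L (fun x y : E => '[x, y]) (fun x => '[u, x]) (`|u| ^+ 2).
  by apply: (@inner_bounded _ _ _ _ id) => x _; rewrite inner_norm.
have u0 := exprn_ge0 2 (normr_ge0 u).
have FF := riesz_filter_proper hK qP phiL phiC u0.
have [|v xv] := @riesz_filter_limit _ _ _ _ _ qP phiL phiC u0 _ id.
  by move=> x y _ _; rewrite inner_norm.
have uv : u - v = 0.
  apply: Lorth => y Ly; rewrite innerBl; apply/eqP; rewrite subr_eq0; apply/eqP.
  apply: (scalar_cvg_unique (riesz_filter_cvg hK qP phiL phiC u0 Ly)).
  exact: inner_cvgl.
rewrite (subr0_eq uv); move/cvgrPdist_lt : xv => /(_ e e0) xv.
have [x [[Lx _] vx]] := filter_ex
  (filterI (riesz_filter_near L (fun x y : E => '[x, y]) (fun x => '[u, x]) ltr01) xv).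
by exists x.
Qed.

End HilbertSpaces.

(** * The Krein-von Neumann extension *)

Section Operators.
Variables (K : numFieldType) (conj : {rmorphism K -> K}).
Hypothesis hK : real_or_complex conj.
Variable H : hilbertType conj.
Implicit Types S T N : set (H * H).

Lemma energy_semi_inner T : positive_operator T ->
  semi_inner conj T (fun x y : H * H => '[x.2, y.1]).
Proof.
move=> [[[T0 Tlin _] Tsym] Tpos]; split=> //.
- by move=> a [f f'] [g g'] Tf Tg; exact: Tlin.
- by move=> a x y z _ _ _; rewrite innerPl.
- by move=> [f f'] [g g'] /= Tf Tg; rewrite (Tsym _ _ _ _ Tg Tf) innerC.
- by move=> [f f'] /= Tf; exact: Tpos.
Qed.

(* Riesz representation of [(f, f') |-> <u, f>] for the form [<f, g> + <f', g>]
   on the graph of [S]. *)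
Lemma resolvent_total S : positive_self_adjoint S ->
  forall u, exists f f', S (f, f') /\ u = f + f'.
Proof.
move=> [posS [_ _ adjS]] u; have [[[S0 Slin _] Ssym] Spos] := posS.
have Slin' a (x y : H * H) : S x -> S y -> S (a *: x + y).
  by case: x y => [f f'] [g g'] Sf Sg; exact: Slin.
have fstP := @semi_inner_comp _ _ _ S H fst S0 Slin' (fun _ _ _ _ _ => erefl).
have qP := semi_innerD fstP (energy_semi_inner posS).
set q := (fun x y : H * H => _) in qP.
have fst_le (x : H * H) : S x -> `|x.1| ^+ 2 <= q x x.
  by case: x => f f' Sf; rewrite inner_norm lerDl; exact: Spos.
have phiL := @inner_antilinear _ _ _ _ S fst u (fun _ _ _ _ _ => erefl).
have phiC := inner_bounded hK u fst_le.
have u0 := exprn_ge0 2 (normr_ge0 u).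
have FF := riesz_filter_proper hK qP phiL phiC u0.
have [|v xv] := riesz_filter_limit hK qP phiL phiC u0 (p := fst).
  by move=> x y Sx Sy; apply: (fst_le (x - y)); exact: (semi_inner_closedB qP).
exists v, (u - v); split; last by rewrite addrC subrK.
(* Only the first components are known to converge in [H], so membership of the limit in [S] is
   obtained through [S = S^*], by testing against the graph of [S]. *)
rewrite -adjS => g g' Sg; rewrite /= innerBr.
suff : '[u, g] = '[v, g + g'].
  rewrite innerDr => /(congr1 conj); rewrite rmorphD -!innerC => ->.
  by rewrite addrC addKr.
apply: (scalar_cvg_unique (riesz_filter_cvg hK qP phiL phiC u0 Sg)).
apply: cvg_trans (inner_cvgl hK (y := g + g') xv); apply: near_eq_cvg.
apply: filterS (riesz_filter_near S q (fun x => '[u, x.1]) ltr01) => -[f f'] [/= Sf _].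
by rewrite /q /= innerDr (Ssym _ _ _ _ Sf Sg).
Qed.

(** A vector orthogonal to [dom N], written [f + f'], satisfies [|f|^2 + <f', f> = 0] and so
    vanishes. For [(a, b)] in the adjoint, solving [a + b = f + f'] makes [a - f] orthogonal to the
    range of [I + N], which is everything. *)
Lemma positive_self_adjoint_of_resolvent N : positive_operator N ->
  (forall u, exists f f', N (f, f') /\ u = f + f') -> positive_self_adjoint N.
Proof.
move=> posN Nsurj; split=> //; have [[[N0 Nlin Nfun] Nsym] Npos] := posN.
split=> //.
  apply: (dense_of_orthogonal0 hK); first by exists (0, 0).
    move=> a _ _ [[f f'] Nf <-] [[g g'] Ng <-].
    by exists (a *: f + g, a *: f' + g') => //; exact: Nlin.
  move=> x xN; have [f [f' [Nf xE]]] := Nsurj x.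
  have : '[x, f] = 0 by apply: xN; exists (f, f').
  rewrite xE innerDl => /eqP; rewrite paddr_eq0 ?inner_ge0 ?(Npos _ _ Nf)//.
  move=> /andP[/eqP/inner_eq0 f0 _]; rewrite f0 in Nf *.
  by rewrite (Nfun _ _ _ Nf N0) addr0.
apply/seteqP; split=> [[a b] /= adjN|[g g'] Ng f f' Nf /=]; last first.
  exact: Nsym.
have [f [f' [Nf abE]]] := Nsurj (a + b).
have af : a - f = 0.
  have [g [g' [Ng afE]]] := Nsurj (a - f).
  apply: inner_eq0; rewrite {1}afE innerDl !innerBr (adjN _ _ Ng) (Nsym _ _ _ _ Ng Nf).
  have -> : b = f + f' - a by rewrite -abE addrAC subrr add0r.
  by rewrite innerBr innerDr; ring.
have bf : b = f' by apply: (addrI a); rewrite abE -(subr0_eq af).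
by rewrite (subr0_eq af) bf.
Qed.

(** * The operator [J^** J^*] attached to an energy space *)

Section Energy.
Variables (T : set (H * H)) (E : hilbertType conj) (j : H -> E).
Hypotheses (posT : positive_operator T) (extT : exists S, psa_extension T S).
Hypothesis jP : energy_space T j.

Let A := adjoint (energy_map T j).
Let N := krein_von_neumann T j.

Lemma energy_adjointP g e : A (g, e) <-> forall x, ran T x -> '[x, g] = '[j x, e].
Proof.
split=> [Age x Tx|Age _ _ [x Tx [<- <-]]]; last exact: Age.
by apply: (Age (j x) x); exists x.
Qed.

Lemma energy_adjoint_linear a x y : A x -> A y -> A (a *: x + y).
Proof.
case: x y => [f e] [g d] /energy_adjointP Af /energy_adjointP Ag.
by apply/energy_adjointP => z Tz; rewrite /= !innerPr Af// Ag.
Qed.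

Lemma energy_adjoint0 : A 0.
Proof.
by apply/energy_adjointP => z Tz /=; rewrite !inner0r.
Qed.

Lemma energy_adjoint_fun g e d : A (g, e) -> A (g, d) -> e = d.
Proof.
move=> /energy_adjointP Ae /energy_adjointP Ad; apply/eqP; rewrite -subr_eq0; apply/eqP.
have [_ _ jd] := jP; apply: (dense_inner0 hK jd) => _ [x Tx <-].
by rewrite innerBr -Ae// -Ad// subrr.
Qed.

Lemma energy_adjoint_ext f f' : T (f, f') -> A (f, j f').
Proof.
move=> Tf; apply/energy_adjointP => x [[h h'] Th <-] /=.
by have [_ jin _] := jP; rewrite (jin _ _ _ _ Th Tf).
Qed.

Lemma dom_extension_sub S g g' : psa_extension T S -> S (g, g') ->
  exists2 e, A (g, e) & '[e, e] <= '[g', g].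
Proof.
move=> [[posS _] TS] Sg; have qP := energy_semi_inner posT.
have [[_ Ssym] Spos] := posS; have gg0 := Spos _ _ Sg.
set q := (fun x y : H * H => _) in qP.
have [jlin jin jd] := jP.
pose phi (x : H * H) := '[g', x.1].
have phiL := @inner_antilinear _ _ _ _ T fst g' (fun _ _ _ _ _ => erefl).
(* [<g', h>] is the energy form of [S] between [(g, g')] and [(h, T h)], so Cauchy-Schwarz for [S]
   applies. *)
have phiC : bounded_by T q phi '[g', g].
  by move=> x Tx; apply: (semi_inner_CS hK (energy_semi_inner posS) Sg (TS _ Tx)).
have FF := riesz_filter_proper hK qP phiL phiC gg0.
have jB x y : ran T x -> ran T y -> j (x - y) = j x - j y.
  by move=> Tx Ty; rewrite addrC -scaleN1r jlin// scaleN1r addrC.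
have ranT (x : H * H) : T x -> ran T x.2 by exists x.
have [|e xe] := riesz_filter_limit hK qP phiL phiC gg0 (p := fun x => j x.2).
  move=> x y Tx Ty; rewrite -jB ?inner_norm; [|exact: ranT..].
  have := semi_inner_closedB qP Tx Ty; case: x y Tx Ty => [f f'] [h h'] Tf Th.
  rewrite -[X in T X]/(f - h, f' - h') => Tfh.
  by rewrite /= (jin _ _ _ _ Tfh Tfh).
have phie y : T y -> phi y = '[e, j y.2].
  move=> Ty; apply: (scalar_cvg_unique (riesz_filter_cvg hK qP phiL phiC gg0 Ty)).
  apply: cvg_trans (inner_cvgl hK (y := j y.2) xe); apply: near_eq_cvg.
  apply: filterS (riesz_filter_near T q phi ltr01) => -[f f'] [Tf _].
  by case: y Ty => h h' Th; rewrite (jin _ _ _ _ Tf Th).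
exists e.
  apply/energy_adjointP => _ [[h h'] Th <-] /=.
  rewrite innerC [RHS]innerC; congr (conj _).
  by rewrite -(Ssym _ _ _ _ Sg (TS _ Th)); exact: (phie _ Th).
(* Along the filter, [phi x = <e, j x.2>] tends to [<e, e>] and [|j x.2|^2] to [|e|^2], so [phiC]
   becomes [<e, e>^2 <= <g', g> <e, e>]. *)
apply: sqr_le_linear; rewrite ?inner_ge0//.
have ee := inner_cvgr hK (FF := FF) (y := e) xe.
rewrite -[X in X ^+ 2]ger0_norm ?inner_ge0//.
rewrite -[X in _ <= _ * X]inner_norm.
apply: (cvg_le_of_near (cvg_norm_sqr (E := K^o) ee)
  (cvgMl_tmp (a := '[g', g]) (cvg_norm_sqr xe))).
apply: filterS (riesz_filter_near T q phi ltr01) => -[f f'] [Tf _].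
by rewrite -(phie _ Tf) inner_norm (jin _ _ _ _ Tf Tf); exact: phiC.
Qed.

(** The dense domain of any positive self-adjoint extension lies in that of [J^*]. This is what
    makes [J^**] single-valued. *)
Lemma dense_dom_energy_adjoint : dense (dom A).
Proof.
have [S extS] := extT; have [[_ [_ Sd _]] _] := extS.
move=> O O0 Oo; have [g [Og [[h g'] Sg /= hg]]] := Sd O O0 Oo.
exists g; split=> //; rewrite -hg in Og *.
by have [e Ae _] := dom_extension_sub extS Sg; exists (h, e).
Qed.

Lemma krein_linear : linear_operator N.
Proof.
split=> [|a f f' g g' [e Ae Be] [d Ad Bd]|f g g' [e Ae Be] [d Ad Bd]].
- exists 0; first exact: energy_adjoint0.
  by move=> g e Ag /=; rewrite !inner0r.
- exists (a *: e + d); first exact: (energy_adjoint_linear a Ae Ad).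
  by move=> h c Ah; rewrite /= !innerPr (Be _ _ Ah) (Bd _ _ Ah).
rewrite /= in Ae Be Ad Bd; rewrite (energy_adjoint_fun Ad Ae) in Bd.
apply/eqP; rewrite -subr_eq0; apply/eqP.
apply: (dense_inner0 hK dense_dom_energy_adjoint) => _ [[h c] Ah <-].
by rewrite innerBr /= -(Be _ _ Ah) -(Bd _ _ Ah) subrr.
Qed.

(** Since [N = A^* A], [<N f, g> = <A f, A g>]. *)
Lemma krein_positive : positive_operator N.
Proof.
split; last first.
  move=> f f' [e Ae Be]; rewrite /= in Ae Be.
  by rewrite innerC -(Be _ _ Ae) -innerC inner_ge0.
split=> [|f f' g g' [e Ae Be] [d Ad Bd]]; first exact: krein_linear.
by rewrite /= in Ae Be Ad Bd; rewrite -(Bd _ _ Ae) innerC -(Be _ _ Ad) -innerC.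
Qed.

(** [J^* f = j (T f)], and [J^**] extends [J], which sends [j (T f)] back to [T f]. *)
Lemma krein_extends : T `<=` N.
Proof.
move=> [f f'] Tf; exists (j f'); first exact: energy_adjoint_ext.
move=> g e /energy_adjointP Ag /=.
have ranf : ran T f' by exists (f, f').
by rewrite innerC -Ag// -innerC.
Qed.

(** Both components of the approximants converge, and their limit [(f, e)] stays in [A] because
    adjoints are closed. The limit identity [<u, g> = <f, g> + <e, A g>] says that
    [A^* e = u - f]. *)
Lemma krein_resolvent u : exists f f', N (f, f') /\ u = f + f'.
Proof.
have A0 : A (0 : H * E) := energy_adjoint0.
have qP := semi_innerD
  (@semi_inner_comp _ _ _ A H fst A0 energy_adjoint_linear (fun _ _ _ _ _ => erefl))
  (@semi_inner_comp _ _ _ A E snd A0 energy_adjoint_linear (fun _ _ _ _ _ => erefl)).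
set q := (fun x y : H * E => _) in qP.
have fst_le (x : H * E) : A x -> `|x.1| ^+ 2 <= q x x.
  by move=> _; rewrite inner_norm lerDl inner_ge0.
have snd_le (x : H * E) : A x -> `|x.2| ^+ 2 <= q x x.
  by move=> _; rewrite inner_norm lerDr inner_ge0.
have phiL := @inner_antilinear _ _ _ _ A fst u (fun _ _ _ _ _ => erefl).
have phiC := inner_bounded hK u fst_le.
have u0 := exprn_ge0 2 (normr_ge0 u).
have FF := riesz_filter_proper hK qP phiL phiC u0.
have [|f xf] := riesz_filter_limit hK qP phiL phiC u0 (p := fst).
  by move=> x y Ax Ay; apply: (fst_le (x - y)); exact: (semi_inner_closedB qP).
have [|e xe] := riesz_filter_limit hK qP phiL phiC u0 (p := snd).
  by move=> x y Ax Ay; apply: (snd_le (x - y)); exact: (semi_inner_closedB qP).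
have nearA := riesz_filter_near A q (fun x => '[u, x.1]) ltr01.
exists f, (u - f); split; last by rewrite addrC subrK.
exists e => /=.
  apply/energy_adjointP => z Tz.
  apply: (scalar_cvg_unique (inner_cvgr hK (y := z) xf)).
  apply: cvg_trans (inner_cvgr hK (y := j z) xe); apply: near_eq_cvg.
  by apply: filterS nearA => -[g d] [/energy_adjointP Ag _]; rewrite /= Ag.
move=> g d Ag /=; rewrite innerBr.
suff : '[u, g] = '[f, g] + '[e, d].
  move=> /(congr1 conj); rewrite rmorphD -!innerC => ->.
  by rewrite addrC addKr.
apply: (scalar_cvg_unique (riesz_filter_cvg hK qP phiL phiC u0 Ag)).
exact: cvgD (inner_cvgl hK (y := g) xf) (inner_cvgl hK (y := d) xe).
Qed.

Lemma krein_form_le S : psa_extension T S -> form_le N S.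
Proof.
move=> extS u; have [psaS _] := extS; have [_ Spos] := psaS.1.
have [g [g' [Sg uE]]] := resolvent_total psaS u.
have [h [h' [Nh uE']]] := krein_resolvent u.
exists g, h; split; first by exists g'.
  by exists h'.
have [e Ae Be] := Nh; rewrite /= in Ae Be.
have [d Ad dd] := dom_extension_sub extS Sg.
have qP := semi_innerD
  (@semi_inner_comp _ _ _ A H fst energy_adjoint0 energy_adjoint_linear (fun _ _ _ _ _ => erefl))
  (@semi_inner_comp _ _ _ A E snd energy_adjoint0 energy_adjoint_linear (fun _ _ _ _ _ => erefl)).
have := semi_inner_CS hK qP Ad Ae; rewrite /= => CS.
(* Pairing [u = h + A^* A h] with an element of [dom A] gives its graph inner product with [h]. *)
have hu : '[h, u] = '[h, h] + '[e, e] by rewrite {1}uE' innerDr (Be _ _ Ae).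
have gu : '[g, u] = '[g, h] + '[d, e] by rewrite {1}uE' innerDr (Be _ _ Ad).
have gg : '[g, g] + '[d, d] <= '[g, u].
  rewrite uE innerDr lerD2l; apply: le_trans dd _.
  by have [[_ Ssym] _] := psaS.1; rewrite (Ssym _ _ _ _ Sg Sg).
have gu0 : 0 <= '[g, u] by apply: le_trans gg; rewrite addr_ge0 ?inner_ge0.
have hu0 : 0 <= '[h, u] by rewrite hu addr_ge0 ?inner_ge0.
apply: sqr_le_linear => //; rewrite -[X in X ^+ 2]ger0_norm// {1}gu.
apply: le_trans CS _; rewrite -hu mulrC ler_wpM2l//.
Qed.

End Energy.
End Operators.

(** The graph of [T] is completed first, and [ran T] is then embedded by choosing preimages. The
    choice is immaterial: [(f, x) - (g, x)] has second component 0, hence zero energy. *)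
Lemma energy_space_ex (K : numFieldType) (conj : {rmorphism K -> K})
    (hK : real_or_complex conj) (H : hilbertType conj) (T : set (H * H)) :
  positive_operator T -> exists (E : hilbertType conj) (j : H -> E), energy_space T j.
Proof.
move=> posT; have qP := energy_semi_inner posT; have [[[T0 Tlin _] _] _] := posT.
have [E [i [ilin iin id]]] := hilbert_completion_ex hK qP.
have iB y z : T y -> T z -> i (y - z) = i y - i z.
  by move=> Ty Tz; rewrite addrC -scaleN1r ilin// scaleN1r addrC.
have i_fst f g x : T (f, x) -> T (g, x) -> i (f, x) = i (g, x).
  move=> Tf Tg; have Tfg : T ((f, x) - (g, x)) by exact: (semi_inner_closedB qP).
  apply/eqP; rewrite -subr_eq0; apply/eqP/inner_eq0.
  rewrite -iB//.
  by rewrite iin//= subrr inner0l.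
have /choice [pre preP] x : exists f, ran T x -> T (f, x).
  by have [[[f x'] Tf <-]|] := pselect (ran T x); [exists f|exists 0].
exists E, (fun x => i (pre x, x)).
have iE f x : T (f, x) -> i (pre x, x) = i (f, x).
  by move=> Tf; apply: i_fst => //; apply: preP; exists (f, x).
split.
- move=> a _ _ [[f f'] Tf <-] [[g g'] Tg <-] /=.
  rewrite (iE _ _ Tf) (iE _ _ Tg) (iE (a *: f + g)); first exact: (ilin a _ _ Tf Tg).
  exact: Tlin.
- by move=> f f' g g' Tf Tg; rewrite (iE _ _ Tf) (iE _ _ Tg) iin.
suff -> : (fun x => i (pre x, x)) @` ran T = i @` T by [].
apply/seteqP; split=> [_ [_ [[f x] Tf <-] <-]|_ [[f x] Tf <-]] /=.
  by exists (f, x) => //; rewrite (iE _ _ Tf).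
by exists x; [exists (f, x)|rewrite (iE _ _ Tf)].
Qed.

(** The first half keeps the second from being vacuous; quantifying over all energy spaces makes the
    result independent of the chosen completion. *)
Theorem theorem3p1 (K : numFieldType) (conj : {rmorphism K -> K})
    (hK : real_or_complex conj) (H : hilbertType conj) (T : set (H * H))
    (posT : positive_operator T) (extT : exists S, psa_extension T S) :
  (exists (E : hilbertType conj) (j : H -> E), energy_space T j) /\
  (forall (E : hilbertType conj) (j : H -> E), energy_space T j ->
     smallest_psa_extension T (krein_von_neumann T j)).
Proof.
split=> [|E j jP]; first exact: (energy_space_ex hK posT).
split; last by move=> S; exact: (krein_form_le hK posT jP).
split; last exact: (krein_extends jP).
apply: (positive_self_adjoint_of_resolvent hK).
  exact: (krein_positive hK posT extT jP).
exact: krein_resolvent.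
Qed.
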